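(* Let $\mathbf{A},\mathbf{B}$ be symmetric $n\times n$ real matrices, and assume that $\mathbf{B}$ is positive definite and strictly diagonally dominant. Let $\lambda\in\mathbb{R}$ be a complementarity eigenvalue of $(\mathbf{A},\mathbf{B})$. Then $$\lambda\in K_1:=\bigcup_{i\in[n]}\left[\min\left(\frac{a_i^-}{b_i^-},\frac{a_i^-}{b_i^+}\right),\ \max\left(\frac{a_i^+}{b_i^-},\frac{a_i^+}{b_i^+}\right)\right].$$
   Context: $[n]=\{1,\dots,n\}$; vector inequalities are componentwise. A real number $\lambda$ is a complementarity eigenvalue of $(\mathbf{A},\mathbf{B})$ if there is $\mathbf{x}\in\mathbb{R}^n$ with $(\mathbf{A}-\lambda\mathbf{B})\mathbf{x}\ge\mathbf{0}$, $\mathbf{x}\ge\mathbf{0}$, $\mathbf{x}^\top(\mathbf{A}-\lambda\mathbf{B})\mathbf{x}=0$ and $\sum_{i=1}^n x_i=1$. A matrix $\mathbf{M}=(m_{ij})$ is strictly diagonally dominant if $|m_{ii}|>\sum_{j\ne i}|m_{ij}|$ for every $i\in[n]$. For $\mathbf{M}\in\mathbb{R}^{n\times n}$ and $i\in[n]$, set $$r_i^+(\mathbf{M}):=\sum_{j\ne i}\max\{m_{ij},0\},\quad r_i^-(\mathbf{M}):=-\sum_{j\ne i}\min\{m_{ij},0\},$$ $$m_i^+:=m_{ii}+r_i^+(\mathbf{M}),\quad m_i^-:=m_{ii}-r_i^-(\mathbf{M}).$$ Thus $a_i^\pm$ and $b_i^\pm$ denote these quantities for $\mathbf{M}=\mathbf{A}=(a_{ij})$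 and $\mathbf{M}=\mathbf{B}=(b_{ij})$ respectively. *)

(* Defs.v *)
From mathcomp Require Import all_boot all_order all_algebra.
From mathcomp Require Import classical_sets set_interval reals.

Set Implicit Arguments.
Unset Strict Implicit.
Unset Printing Implicit Defensive.

Import Order.TTheory GRing.Theory Num.Theory.

Local Open Scope classical_set_scope.
Local Open Scope ring_scope.

Section Definitions.
Variables (R : realType) (n : nat).
Implicit Types (A B M : 'M[R]_n) (x : 'cV[R]_n) (i : 'I_n) (lambda : R).

Definition qform M x : R := (x^T *m M *m x) 0 0.

(* Symmetry is not part of this predicate. *)
Definition posdefmx M : Prop := forall x, x != 0 -> 0 < qform M x.

Definition strictly_diag_dominant M : Prop :=
  forall i, \sum_(j < n | j != i) `|M i j| < `|M i i|.

Definition complementarity_eigenvalue A B lambda : Prop :=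
  exists x, [/\ forall i, 0 <= ((A - lambda *: B) *m x) i 0,
                forall i, 0 <= x i 0,
                qform (A - lambda *: B) x = 0
              & \sum_(i < n) x i 0 = 1].

Definition rplus M i : R := \sum_(j < n | j != i) Num.max (M i j) 0.

Definition rminus M i : R := - \sum_(j < n | j != i) Num.min (M i j) 0.

(* [dplus M i] and [dminus M i] are $m_i^+$ and $m_i^-$. *)
Definition dplus M i : R := M i i + rplus M i.

Definition dminus M i : R := M i i - rminus M i.

Definition K1 A B : set R :=
  \bigcup_(i : 'I_n)
    `[Num.min (dminus A i / dminus B i) (dminus A i / dplus B i),
      Num.max (dplus A i / dminus B i) (dplus A i / dplus B i)]%classic.

End Definitions.

(* Main.v *)
(** Choose [i] maximizing [x_i]; then [x_i > 0], and complementarity forces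
    [(A x)_i = lambda (B x)_i].  Since [0 <= x_j <= x_i] for all [j], every matrix
    [M] satisfies [m_i^- x_i <= (M x)_i <= m_i^+ x_i].  Apply this to [A] and [B]
    and split on the sign of [lambda]; strict diagonal dominance and [b_ii > 0]
    give [b_i^- > 0]. *)
Require Import Defs.
From mathcomp Require Import all_boot all_order all_algebra.
From mathcomp Require Import classical_sets set_interval reals.

Import Order.TTheory GRing.Theory Num.Theory.

Local Open Scope ring_scope.

(** Off the diagonal, [0 <= x j 0] lets [M i j] grow to its positive part, and nonnegativity of that
    part then lets [x j 0] grow to [x i 0]. *)
Lemma mulmx_row_le_dplus (R : realType) (n : nat) (M : 'M[R]_n) (x : 'cV[R]_n)
    (i : 'I_n) :
  (forall j, 0 <= x j 0 <= x i 0) -> (M *m x) i 0 <= dplus M i * x i 0.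
Proof.
move=> xP; rewrite mxE (bigD1 i) //= mulrDl lerD2l mulr_suml.
apply: ler_sum => j _; have /andP[xj0 xji] := xP j.
apply: (@le_trans _ _ (Num.max (M i j) 0 * x j 0)).
  by rewrite ler_wpM2r // le_max lexx.
by rewrite ler_wpM2l // le_max lexx orbT.
Qed.

(** Turns the upper row bound for [- M] into the lower row bound for [M]. *)
Lemma dplusN (R : realType) (n : nat) (M : 'M[R]_n) (i : 'I_n) :
  dplus (- M) i = - dminus M i.
Proof.
rewrite /dplus /dminus /rplus /rminus mxE opprK opprD; congr (_ + _).
rewrite -sumrN; apply: eq_bigr => j _.
by rewrite mxE -[in LHS]oppr0 -oppr_min.
Qed.

Lemma dminus_le_mulmx_row (R : realType) (n : nat) (M : 'M[R]_n) (x : 'cV[R]_n)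
    (i : 'I_n) :
  (forall j, 0 <= x j 0 <= x i 0) -> dminus M i * x i 0 <= (M *m x) i 0.
Proof.
move=> /(mulmx_row_le_dplus R n (- M)).
by rewrite mulNmx mxE dplusN mulNr lerN2.
Qed.

(** Evaluate the quadratic form at the [i]-th basis vector. *)
Lemma posdefmx_diag_gt0 (R : realType) (n : nat) (M : 'M[R]_n) (i : 'I_n) :
  posdefmx M -> 0 < M i i.
Proof.
move=> /(_ (delta_mx i 0)); rewrite /qform trmx_delta -rowE -colE !mxE; apply.
by apply/eqP => /matrixP /(_ i 0); rewrite !mxE !eqxx; apply/eqP/oner_neq0.
Qed.

Lemma strictly_diag_dominant_dminus_gt0 (R : realType) (n : nat) (M : 'M[R]_n)
    (i : 'I_n) :
  strictly_diag_dominant M -> 0 < M i i -> 0 < dminus M i.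
Proof.
move=> sddM Mii; have := sddM i; rewrite (gtr0_norm Mii) /dminus subr_gt0.
apply: le_lt_trans; rewrite /rminus -sumrN; apply: ler_sum => j _.
(* Termwise, the negative part of an entry is at most its absolute value. *)
by rewrite oppr_min oppr0 ge_max normr_ge0 -normrN ler_norm.
Qed.

Lemma dminus_le_dplus (R : realType) (n : nat) (M : 'M[R]_n) (i : 'I_n) :
  dminus M i <= dplus M i.
Proof.
rewrite /dminus /rminus opprK lerD2l; apply: ler_sum => j _.
by rewrite ge_min le_max lexx.
Qed.

(** The form is a sum of nonnegative terms, each an entry of [x] times the same entry of [M *m x]; a
    zero sum makes every term vanish. *)
Lemma complementarity_slack (R : realType) (n : nat) (M : 'M[R]_n)
    (x : 'cV[R]_n) (i : 'I_n) :
  (forall j, 0 <= (M *m x) j 0) -> (forall j, 0 <= x j 0) ->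
  qform M x = 0 -> 0 < x i 0 -> (M *m x) i 0 = 0.
Proof.
move=> Mx0 x0; rewrite /qform -mulmxA mxE => /eqP.
rewrite psumr_eq0 => [/allP/(_ i (mem_index_enum _))|j _]; last first.
  by rewrite mxE mulr_ge0.
by rewrite /= mxE mulf_eq0 => /orP[/eqP->|/eqP//]; rewrite ltxx.
Qed.

Lemma exists_max_entry_gt0 (R : realDomainType) (n : nat) (x : 'cV[R]_n) :
  0 < \sum_i x i 0 -> exists2 i, 0 < x i 0 & forall j, x j 0 <= x i 0.
Proof.
move=> sx; have [i0 xi0|x0] := pickP (fun i => 0 < x i 0); last first.
  by move: sx; rewrite ltNge sumr_le0 // => i _; rewrite leNgt x0.
(* The positive entry at [i0] shows that the index set is inhabited and bounds the maximum from
   below. *)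
have [i _ xi] := Order.TotalTheory.arg_maxP (fun j => x j 0) (erefl (predT i0)).
by exists i => [|j]; [apply: lt_le_trans xi0 _|]; apply: xi.
Qed.

Theorem theorem2p2 (R : realType) (n : nat) (A B : 'M[R]_n) (lambda : R)
    (symA : A \is symmetricmx) (symB : B \is symmetricmx)
    (posB : posdefmx B) (sddB : strictly_diag_dominant B)
    (eigAB : complementarity_eigenvalue A B lambda) :
  K1 A B lambda.
Proof.
case: eigAB => x [Cx0 x0 qx0 sx1].
have [i xi xmax] : exists2 i, 0 < x i 0 & forall j, x j 0 <= x i 0.
  by apply: exists_max_entry_gt0; rewrite sx1.
have xP j : 0 <= x j 0 <= x i 0 by rewrite x0 xmax.
have /eqP : ((A - lambda *: B) *m x) i 0 = 0 by apply: complementarity_slack.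
(* Stated for arbitrary [u] and [v] so that the products with [x] are not expanded into sums. *)
have subZE (u v : 'cV[R]_n) : (u - lambda *: v) i 0 = u i 0 - lambda * v i 0.
  by rewrite !mxE.
rewrite mulmxBl -scalemxAl subZE subr_eq0 => /eqP AxBx.
have bm0 : 0 < dminus B i.
  by apply: strictly_diag_dominant_dminus_gt0 => //; apply: posdefmx_diag_gt0.
have bp0 : 0 < dplus B i := lt_le_trans bm0 (dminus_le_dplus _ _ _ _).
have Alo := dminus_le_mulmx_row _ _ A _ _ xP.
have Ahi := mulmx_row_le_dplus _ _ A _ _ xP.
have Blo := dminus_le_mulmx_row _ _ B _ _ xP.
have Bhi := mulmx_row_le_dplus _ _ B _ _ xP.
exists i => //=; rewrite in_itv /= ge_min le_max.
rewrite !ler_pdivlMr // !ler_pdivrMr //.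
(* One quotient per endpoint suffices. If [0 <= lambda], the lower one uses [dplus B i] and the
   upper one [dminus B i]; a negative [lambda] reverses the bounds on [B *m x] and swaps these
   roles. *)
have [l0|/ltW l0] := leP 0 lambda; apply/andP; split; apply/orP.
- right; rewrite -(ler_pM2r xi) -mulrA.
  by apply: (le_trans Alo); rewrite AxBx ler_wpM2l.
- left; rewrite -(ler_pM2r xi) -mulrA.
  by apply: le_trans Ahi; rewrite AxBx ler_wpM2l.
- left; rewrite -(ler_pM2r xi) -mulrA.
  by apply: (le_trans Alo); rewrite AxBx ler_wnM2l.
- right; rewrite -(ler_pM2r xi) -mulrA.
  by apply: le_trans Ahi; rewrite AxBx ler_wnM2l.
Qed.
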